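(* Let $\mathcal{H}$ be a complex Hilbert space and let $A \in \mathcal{B}(\mathcal{H})$. Then $$w^2(A)\geq \frac{1}{4}\left\|A^*A+AA^*\right\|+\frac{1}{2}\Big|\,\|\Re(A)\|^2-\|\Im(A)\|^2\,\Big|.$$
   Context: $\mathcal{B}(\mathcal{H})$ denotes the algebra of all bounded linear operators on the complex Hilbert space $\mathcal{H}$, with operator norm $\|\cdot\|$ and adjoint $A^*$. The numerical radius is $w(A)=\sup\{|\langle Ax,x\rangle| : x\in\mathcal{H},\ \|x\|=1\}$, and $w^2(A)=(w(A))^2$. The real and imaginary parts are the operators $\Re(A)=\frac{A+A^*}{2}$ and $\Im(A)=\frac{A-A^*}{2\mathrm{i}}$. *)

(* Defs.v *)
From HB Require Import structures.
From mathcomp Require Import all_boot all_order all_algebra.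
From mathcomp Require Import sesquilinear.
From mathcomp Require Import all_classical all_reals all_analysis.
From mathcomp Require Import complex.

Set Implicit Arguments.
Unset Strict Implicit.
Unset Printing Implicit Defensive.

Import Order.TTheory GRing.Theory Num.Theory.
Import numFieldNormedType.Exports.

Local Open Scope classical_set_scope.
Local Open Scope ring_scope.

(* A complex Hilbert space: a Banach space over R[i] whose norm comes from an
   inner product, linear in its first argument and conjugate-linear in its
   second one. *)
HB.mixin Record CompleteNormedModule_isHilbert (R : realType) H
    & CompleteNormedModule R[i] H := {
  inner : {dot H for (@Num.conj R[i])} ;
  sqr_norm_inner : forall x : H, `|x| ^+ 2 = inner x x
}.

#[short(type="hilbertType")]
HB.structure Definition Hilbert (R : realType) :=
  {H of CompleteNormedModule R[i] H & CompleteNormedModule_isHilbert R H}.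

Section Operators.
Context {R : realType} {H : hilbertType R}.
Implicit Types (A B : H -> H) (x y : H).

(* The norms of R[i] and of H take (real nonnegative) values in R[i];
   modulus and hnorm are these values seen in R. *)
Definition modulus (z : R[i]) : R := complex.Re `|z|.
Definition hnorm x : R := complex.Re `|x|.

Definition bounded_operator A : Prop :=
  exists M : R, forall x, hnorm (A x) <= M * hnorm x.

(* On the zero space both suprema below are 0, since sup set0 = 0. *)
Definition opnorm A : R := sup [set hnorm (A x) | x in [set x | hnorm x <= 1]].

Definition numerical_radius A : R :=
  sup [set modulus (inner (A x) x) | x in [set x | hnorm x = 1]].

Definition is_adjoint A B : Prop :=
  forall x y, inner (A x) y = inner x (B y).

(* By the Riesz representation theorem a bounded linear operator has an
   adjoint, so that the default value is not used for such operators. *)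
Definition adjoint A : H -> H := xget (fun=> 0) [set B | is_adjoint A B].

Definition real_part A : H -> H :=
  fun x => 2^-1 *: (A x + adjoint A x).

Definition imaginary_part A : H -> H :=
  fun x => (2 * 'i%C)^-1 *: (A x - adjoint A x).

Lemma adjoint_unique A B : is_adjoint A B -> adjoint A = B.
Proof.
move=> AB; rewrite /adjoint; case: xgetP => [B' _ AB'|/(_ B)//].
apply/funext => y; apply/eqP; rewrite -subr_eq0.
apply: contraT => /(@neq0_dnorm_gt0 _ _ _ (@inner R H)).
by rewrite raddfB /= -AB -AB' subrr ltxx.
Qed.

End Operators.

(* Main.v *)
(** Let T and S be the real and imaginary parts of A, so that A = T + iS with T
    and S self-adjoint and A^*A + AA^* = 2 (T^2 + S^2); hence
    (1/4)|A^*A + AA^*| <= (|T|^2 + |S|^2) / 2, and the right-hand side of the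
    theorem is at most max(|T|^2, |S|^2). By polarization a self-adjoint operator
    has norm at most its numerical radius, and |<Tx, x>|, |<Sx, x>| <= |<Ax, x>|,
    so that |T|, |S| <= w(A). *)
Require Import Defs.
From HB Require Import structures.
From mathcomp Require Import all_boot all_order all_algebra.
From mathcomp Require Import sesquilinear.
From mathcomp Require Import all_classical all_reals all_analysis.
From mathcomp Require Import complex.
From mathcomp Require Import ring lra.
Import Order.TTheory GRing.Theory Num.Theory.
Import numFieldNormedType.Exports.
Local Open Scope ring_scope.

(** A set without a supremum gets the default value 0; the empty unit sphere of the zero space is
    such a case. *)
Lemma sup_nonneg (R : realType) (E : set R) :
  (forall x, E x -> 0 <= x) -> 0 <= sup E.
Proof.
move=> E0; have [Esup|/sup_out -> //] := pselect (has_sup E).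
have [[x Ex] _] := Esup.
by rewrite (le_trans (E0 _ Ex))// sup_upper_bound.
Qed.

(** Serves to add the squares of the real and imaginary parts: the pure squares [a], [d] cancel and
    the mixed products [b], [c] are doubled. *)
Lemma square_sum_sub_square_diff (V : zmodType) (a b c d : V) :
  a + b + (c + d) - (a - b - (c - d)) = (b + c) *+ 2.
Proof.
rewrite !opprB [a + b]addrC [c - d + _]addrC addrACA.
rewrite [b + a + _]addrACA subrr addr0 [c + d + _]addrACA subrr addr0.
by rewrite mulr2n addrACA.
Qed.

Section Hilbert.
Set Implicit Arguments.
Unset Strict Implicit.
Context {R : realType} {H : hilbertType R}.
Implicit Types (x y : H) (c : R[i]) (w : R) (A B : H -> H).

(** * Modulus and norm as real numbers *)

Lemma complex_modulus c : `|c| = (modulus c)%:C%C.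
Proof. by rewrite /modulus RRe_real ?normr_real. Qed.

Lemma complex_hnorm x : `|x| = (hnorm x)%:C%C.
Proof. by rewrite /hnorm RRe_real ?normr_real. Qed.

Lemma modulus_ge0 c : 0 <= modulus c.
Proof. by rewrite -ler0c -complex_modulus normr_ge0. Qed.

Lemma hnorm_ge0 x : 0 <= hnorm x.
Proof. by rewrite -ler0c -complex_hnorm normr_ge0. Qed.

Lemma hnorm0 : hnorm (0 : H) = 0.
Proof. by rewrite /hnorm normr0. Qed.

Lemma hnorm_gt0 x : (0 < hnorm x) = (x != 0).
Proof. by rewrite -ltcR -complex_hnorm normr_gt0. Qed.

Lemma ler_modulusD c d : modulus (c + d) <= modulus c + modulus d.
Proof.
by rewrite -lecR rmorphD /= -!complex_modulus ler_normD.
Qed.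

Lemma ler_hnormD x y : hnorm (x + y) <= hnorm x + hnorm y.
Proof. by rewrite -lecR rmorphD /= -!complex_hnorm ler_normD. Qed.

Lemma modulusM c d : modulus (c * d) = modulus c * modulus d.
Proof. by apply: complexI; rewrite rmorphM /= -!complex_modulus normrM. Qed.

Lemma modulusN c : modulus (- c) = modulus c.
Proof. by rewrite /modulus normrN. Qed.

Lemma modulus_conj c : modulus (Num.conj c) = modulus c.
Proof. by rewrite /modulus norm_conjC. Qed.

Lemma modulus_real w : modulus w%:C%C = `|w|.
Proof. by rewrite /modulus normc_def /= expr0n /= addr0 sqrtr_sqr. Qed.

Lemma modulusV c : modulus c^-1 = (modulus c)^-1.
Proof. by apply: complexI; rewrite fmorphV /= -!complex_modulus normfV. Qed.

Lemma modulus2 : modulus (2 : R[i]) = 2.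
Proof. by rewrite /modulus normr_nat. Qed.

Lemma modulus_i : modulus ('i%C : R[i]) = 1.
Proof. by rewrite /modulus normc_def /= expr0n expr1n add0r sqrtr1. Qed.

Lemma ler_Re_modulus c : complex.Re c <= modulus c.
Proof.
rewrite (le_trans (ler_norm _))// -lecR -complex_modulus; exact: normc_ge_Re.
Qed.

Lemma hnormZ c x : hnorm (c *: x) = modulus c * hnorm x.
Proof.
by apply: complexI; rewrite rmorphM /= -complex_modulus -!complex_hnorm normrZ.
Qed.

(** * Inner product and Cauchy-Schwarz *)

Lemma innerxx x : inner x x = (hnorm x ^+ 2)%:C%C.
Proof. by rewrite -sqr_norm_inner complex_hnorm rmorphXn. Qed.

Lemma innerC x y : inner x y = Num.conj (inner y x).
Proof. by rewrite hermC /= expr0 mul1r. Qed.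

Lemma innerDl x y z : inner (x + y) z = inner x z + inner y z.
Proof. exact: linearDl. Qed.

Lemma innerDr x y z : inner x (y + z) = inner x y + inner x z.
Proof. exact: linearDr. Qed.

Lemma innerNl x y : inner (- x) y = - inner x y.
Proof. exact: linearNl. Qed.

Lemma innerNr x y : inner x (- y) = - inner x y.
Proof. exact: linearNr. Qed.

Lemma innerZl c x y : inner (c *: x) y = c * inner x y.
Proof. by rewrite linearZl_LR. Qed.

Lemma innerZr c x y : inner x (c *: y) = Num.conj c * inner x y.
Proof. by rewrite linearZr_LR. Qed.

Lemma inner_injr x y : (forall z, inner z x = inner z y) -> x = y.
Proof.
move=> xy; apply/eqP; rewrite -subr_eq0.
apply: contraT => /(@neq0_dnorm_gt0 _ _ _ (@inner R H)).
by rewrite innerDr innerNr xy subrr ltxx.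
Qed.

(** The vector [u] is |y|^2 times the component of [x] orthogonal to [y], a multiple chosen to avoid
    division; its squared norm is nonnegative. *)
Lemma inner_Cauchy_Schwarz x y : modulus (inner x y) <= hnorm x * hnorm y.
Proof.
have [->|y0] := eqVneq y 0.
  by rewrite linear0r /modulus normr0 /= mulr_ge0 ?hnorm_ge0.
have ny : 0 < hnorm y by rewrite hnorm_gt0.
pose u := inner y y *: x - inner x y *: y.
have : inner u u =
    (hnorm y ^+ 2 * (hnorm x ^+ 2 * hnorm y ^+ 2 - modulus (inner x y) ^+ 2))%:C%C.
  rewrite /u !(innerDl, innerDr, innerNl, innerNr, innerZl, innerZr).
  rewrite [inner y x]innerC.
  have := normCK (inner x y).
  rewrite complex_modulus (innerxx x) (innerxx y).
  set d := inner x y => /esym dd.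
  have -> : Num.conj (hnorm y ^+ 2)%:C%C = (hnorm y ^+ 2)%:C%C.
    by apply/CrealP; rewrite complex_real.
  rewrite !expr2 in dd *; rewrite !(rmorphM, rmorphB)/=.
  ring: dd.
rewrite innerxx => /complexI e.
have : 0 <= hnorm u ^+ 2 by rewrite sqr_ge0.
rewrite e pmulr_rge0 ?exprn_gt0// subr_ge0 -exprMn ler_pXn2r//.
  by rewrite nnegrE modulus_ge0.
by rewrite nnegrE mulr_ge0 ?hnorm_ge0.
Qed.

(** * Adjoint pairs *)

Lemma is_adjoint_sym A B : is_adjoint A B -> is_adjoint B A.
Proof. by move=> AB x y; rewrite innerC -AB -innerC. Qed.

(** Pairing with an arbitrary [z] reduces this to additivity of [inner] in its second argument. In
    particular a self-adjoint map is automatically additive. *)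
Lemma is_adjoint_additive A B x y : is_adjoint A B -> B (x + y) = B x + B y.
Proof.
by move=> AB; apply: inner_injr => z; rewrite -AB !innerDr !AB.
Qed.

Lemma is_adjoint_scalable A B c x : is_adjoint A B -> B (c *: x) = c *: B x.
Proof.
by move=> AB; apply: inner_injr => z; rewrite -AB !innerZr AB.
Qed.

(** * Polarization for self-adjoint operators *)

Lemma ReD c d : complex.Re (c + d) = complex.Re c + complex.Re d.
Proof. by case: c d => [? ?] []. Qed.

Lemma ReN c : complex.Re (- c) = - complex.Re c.
Proof. by case: c. Qed.

Lemma parallelogram x y :
  hnorm (x + y) ^+ 2 + hnorm (x - y) ^+ 2 = 2 * (hnorm x ^+ 2 + hnorm y ^+ 2).
Proof.
have sq (z : H) : hnorm z ^+ 2 = complex.Re (inner z z) by rewrite innerxx.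
by rewrite !sq !(innerDl, innerDr, innerNl, innerNr) !(ReD, ReN); ring.
Qed.

Lemma hnorm_selfadjoint w A : is_adjoint A A -> 0 <= w ->
  (forall x, modulus (inner (A x) x) <= w * hnorm x ^+ 2) ->
  forall x, hnorm (A x) <= w * hnorm x.
Proof.
move=> AA w0 Aw x.
have AD y z : A (y + z) = A y + A z by exact: is_adjoint_additive.
have AZ c y : A (c *: y) = c *: A y by exact: is_adjoint_scalable.
have AN y : A (- y) = - A y by rewrite -scaleN1r AZ scaleN1r.
set n := hnorm (A x).
(* Polarization for t x and A x; the choice t = w is the optimal one. *)
have polar (t : R) : 4 * t * n ^+ 2 <= 2 * w * (t ^+ 2 * hnorm x ^+ 2 + n ^+ 2).
  pose y := t%:C%C *: x; pose z := A x.
  have yE : hnorm y ^+ 2 = t ^+ 2 * hnorm x ^+ 2.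
    by rewrite hnormZ modulus_real exprMn real_normK ?num_real.
  (* By self-adjointness both cross terms equal [t * n ^+ 2], and each is counted twice. *)
  have : complex.Re (inner (A (y + z)) (y + z) - inner (A (y - z)) (y - z))
      = 4 * t * n ^+ 2.
    have -> : inner (A (y + z)) (y + z) - inner (A (y - z)) (y - z)
        = 2 * (inner (A y) z + inner (A z) y).
      rewrite !(AD, AN, innerDl, innerDr, innerNl, innerNr); ring.
    rewrite [inner (A z) y]AA /y AZ -/z innerZl innerZr innerxx.
    rewrite /= -/n.
    ring.
  rewrite ReD ReN => <-; rewrite -yE.
  (* The parallelogram law adds the bounds at [y + z] and [y - z] up to 2w(|y|^2 + |z|^2). *)
  have := parallelogram y z; rewrite -/n => yz.
  have := Aw (y + z); have := Aw (y - z).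
  have := ler_Re_modulus (inner (A (y + z)) (y + z)).
  have := ler_Re_modulus (- inner (A (y - z)) (y - z)).
  rewrite modulusN ReN; nra.
(* For [w = 0] the choice [t = w] would give only 0 <= 0; [t = 1] forces [n = 0] instead. *)
have [w1|w1] := eqVneq w 0.
  have := polar 1.
  have := sqr_ge0 n; have : 0 <= n by exact: hnorm_ge0.
  rewrite w1 !(mulr0, mul0r) => n0 n20 n2.
  have /eqP : n ^+ 2 = 0 by lra.
  by rewrite sqrf_eq0 => /eqP ->.
have {}w0 : 0 < w by rewrite lt_neqAle eq_sym w1.
have := polar w => p.
have : n ^+ 2 <= (w * hnorm x) ^+ 2.
  rewrite exprMn -(ler_pM2l w0); lra.
by rewrite ler_pXn2r// nnegrE ?mulr_ge0 ?hnorm_ge0 ?ltW.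
Qed.

(** * Operator norm and numerical radius as suprema *)

Lemma hnorm_normalized x : x != 0 -> hnorm ((hnorm x)^-1%:C%C *: x) = 1.
Proof.
rewrite -hnorm_gt0 => x0.
by rewrite hnormZ modulus_real gtr0_norm ?invr_gt0// mulVf ?gt_eqF.
Qed.

Lemma scale_normalized x : x != 0 ->
  (hnorm x)%:C%C *: ((hnorm x)^-1%:C%C *: x) = x.
Proof.
rewrite -hnorm_gt0 => x0.
by rewrite scalerA -rmorphM /= mulfV ?gt_eqF// scale1r.
Qed.

Lemma opnorm_le M A : (forall x, hnorm x <= 1 -> hnorm (A x) <= M) ->
  opnorm A <= M.
Proof.
move=> AM; apply: ge_sup.
  by exists (hnorm (A 0)), 0 => //=; rewrite hnorm0.
by move=> _ [x /= x1 <-]; exact: AM.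
Qed.

(** Homogeneity reduces to the unit vector x/|x|; boundedness makes the set bounded above, so that
    [sup] dominates its elements. *)
Lemma ler_opnorm A : bounded_operator A ->
  (forall c x, A (c *: x) = c *: A x) ->
  forall x, hnorm (A x) <= opnorm A * hnorm x.
Proof.
move=> [M AM] AZ x; have [->|x0] := eqVneq x 0.
  by rewrite (le_trans (AM _))// hnorm0 !mulr0.
rewrite -[in leLHS](scale_normalized x0) AZ hnormZ modulus_real.
rewrite ger0_norm ?hnorm_ge0// mulrC ler_pM2r ?hnorm_gt0//.
apply: ub_le_sup.
  (* [M] carries no sign condition; passing to its absolute value allows |y| <= 1 to be used. *)
  exists `|M| => _ [y /= y1 <-]; rewrite (le_trans (AM _))//.
  rewrite (le_trans (ler_wpM2r (hnorm_ge0 _) (ler_norm M)))//.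
  by rewrite ler_piMr.
by eexists; [|reflexivity]; rewrite /= hnorm_normalized.
Qed.

Lemma numerical_radius_ge0 A : 0 <= numerical_radius A.
Proof. by apply: sup_nonneg => _ [x _ <-]; exact: modulus_ge0. Qed.

Lemma ler_numerical_radius A : bounded_operator A ->
  (forall c x, A (c *: x) = c *: A x) ->
  forall x, modulus (inner (A x) x) <= numerical_radius A * hnorm x ^+ 2.
Proof.
move=> [M AM] AZ x; have [->|x0] := eqVneq x 0.
  by rewrite linear0r /modulus normr0 hnorm0 expr0n mulr0.
rewrite -[in leLHS](scale_normalized x0) AZ innerZl innerZr !modulusM.
rewrite modulus_conj modulus_real ger0_norm ?hnorm_ge0// mulrA -expr2 mulrC.
rewrite ler_pM2r ?exprn_gt0 ?hnorm_gt0//.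
apply: ub_le_sup.
  exists M => _ [y /= y1 <-]; rewrite (le_trans (inner_Cauchy_Schwarz _ _))//.
  by rewrite y1 mulr1 (le_trans (AM _))// y1 mulr1.
by eexists; [|reflexivity]; rewrite /= hnorm_normalized.
Qed.

(** The bound on the quadratic form already makes [A] bounded, so [opnorm A] is a genuine supremum
    and can be applied twice to estimate the square of [A]. *)
Lemma opnorm_selfadjoint w A : is_adjoint A A -> 0 <= w ->
  (forall x, modulus (inner (A x) x) <= w * hnorm x ^+ 2) ->
  opnorm A <= w /\ (forall x, hnorm (A (A x)) <= opnorm A ^+ 2 * hnorm x).
Proof.
move=> AA w0 Aw; have An := hnorm_selfadjoint AA w0 Aw.
have oA : forall x, hnorm (A x) <= opnorm A * hnorm x.
  apply: ler_opnorm; first by exists w.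
  by move=> c x; exact: is_adjoint_scalable.
have oA0 : 0 <= opnorm A.
  by apply: sup_nonneg => _ [x _ <-]; exact: hnorm_ge0.
split.
  apply: opnorm_le => x x1; rewrite (le_trans (An _))//.
  by rewrite ler_piMr.
move=> x; rewrite (le_trans (oA _))// expr2 -mulrA ler_wpM2l//.
Qed.

End Hilbert.

(** * Cartesian decomposition and the lower bound *)

Theorem theorem2p9 (R : realType) (H : hilbertType R) (A : {linear H -> H})
    (A_bounded : bounded_operator A) :
  numerical_radius A ^+ 2 >=
    4^-1 * opnorm ((adjoint A \o A) \+ (A \o adjoint A)) +
    2^-1 * `| opnorm (real_part A) ^+ 2 - opnorm (imaginary_part A) ^+ 2 |.
Proof.
set w := numerical_radius A.
have w0 : 0 <= w by exact: numerical_radius_ge0.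
have AZ (c : R[i]) (x : H) : A (c *: x) = c *: A x by rewrite linearZ.
have AD (x y : H) : A (x + y) = A x + A y by rewrite linearD.
have AN (x : H) : A (- x) = - A x by rewrite linearN.
have Aw : forall x, modulus (inner (A x) x) <= w * hnorm x ^+ 2.
  exact: ler_numerical_radius.
(* Without an adjoint (which Riesz's theorem excludes), [adjoint A] would be the
   default 0, so both parts would have equal norms and the left-hand side would
   vanish: completeness of H is not needed. *)
have [[B AB]|noB] := pselect (exists B, is_adjoint A B); last first.
  have A0 : adjoint A = fun=> 0.
    by rewrite /adjoint; case: xgetP => // B _ AB; case: noB; exists B.
  have -> : opnorm (imaginary_part A) = opnorm (real_part A).
    congr sup; apply/seteqP; split => _ [x x1 <-]; exists x => //;
      rewrite /imaginary_part /real_part A0 subr0 addr0 !hnormZ;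
      by rewrite !modulusV modulusM modulus_i mulr1.
  have o0 : opnorm ((adjoint A \o A) \+ (A \o adjoint A)) <= 0.
    by apply: opnorm_le => x _; rewrite A0 /= linear0 addr0 hnorm0.
  rewrite subrr normr0 mulr0 addr0 (le_trans _ (sqr_ge0 _))//.
  by rewrite mulr_ge0_le0.
have BD x y : B (x + y) = B x + B y by exact: is_adjoint_additive.
have BZ c x : B (c *: x) = c *: B x by exact: is_adjoint_scalable.
have BN x : B (- x) = - B x by rewrite -scaleN1r BZ scaleN1r.
have BA : is_adjoint B A by exact: is_adjoint_sym.
have Bw x : modulus (inner (B x) x) <= w * hnorm x ^+ 2.
  by rewrite BA innerC modulus_conj.
have aA : adjoint A = B by exact: adjoint_unique.
set T := real_part A; set S := imaginary_part A.
have TT : is_adjoint T T.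
  move=> x y; rewrite /T /real_part aA.
  rewrite innerZl innerZr innerDl innerDr AB BA addrC.
  by rewrite fmorphV rmorph_nat.
have SS : is_adjoint S S.
  move=> x y; rewrite /S /imaginary_part aA.
  rewrite innerZl innerZr innerDl innerDr innerNl innerNr AB BA.
  (* Conjugating 1/(2i) changes its sign, which compensates the exchange of [A] and [B] in the
     difference. *)
  rewrite complexiE fmorphV rmorphM rmorph_nat /= conjCi mulrN invrN; ring.
(* The form of [T] is the mean of those of [A] and [B], both bounded by w|x|^2; likewise for [S] up
   to a factor of modulus 1. *)
have Tw x : modulus (inner (T x) x) <= w * hnorm x ^+ 2.
  rewrite /T /real_part aA innerZl innerDl modulusM.
  have := ler_modulusD (inner (A x) x) (inner (B x) x).
  have := Aw x; have := Bw x.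
  have -> : modulus (2^-1 : R[i]) = 2^-1
    by rewrite modulusV ?modulusM ?modulus_i ?mulr1 modulus2.
  lra.
have Sw x : modulus (inner (S x) x) <= w * hnorm x ^+ 2.
  rewrite /S /imaginary_part aA innerZl innerDl innerNl modulusM.
  have := ler_modulusD (inner (A x) x) (- inner (B x) x).
  have := Aw x; have := Bw x; rewrite modulusN.
  have -> : modulus ((2 * 'i%C)^-1 : R[i]) = 2^-1
    by rewrite modulusV ?modulusM ?modulus_i ?mulr1 modulus2.
  lra.
have [Tn T2] := opnorm_selfadjoint TT w0 Tw.
have [Sn S2] := opnorm_selfadjoint SS w0 Sw.
have sumE : opnorm ((adjoint A \o A) \+ (A \o adjoint A)) <=
    2 * (opnorm T ^+ 2 + opnorm S ^+ 2).
  apply: opnorm_le => x x1.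
  have -> : ((adjoint A \o A) \+ (A \o adjoint A)) x = 2 *: (T (T x) + S (S x)).
    have -> : T (T x) = (2^-1 * 2^-1) *:
        (A (A x) + A (B x) + (B (A x) + B (B x))).
      by rewrite /T /real_part aA AZ BZ -scalerDr scalerA AD BD.
    (* The minus sign is that of (1/(2i))^2 = -1/4. *)
    have -> : S (S x) = - (2^-1 * 2^-1) *:
        (A (A x) - A (B x) - (B (A x) - B (B x))).
      rewrite /S /imaginary_part aA AZ BZ -scalerBr scalerA !(AD, BD) AN BN.
      rewrite invfM mulrACA.
      by rewrite -['i%C^-1 * _]invfM -['i%C * _]expr2 sqr_i invrN1 mulrN1.
    rewrite scaleNr -scalerBr square_sum_sub_square_diff.
    rewrite scalerA -scalerMnr scalerMnl.
    have -> : (2 * (2^-1 * 2^-1)) *+ 2 = 1 :> R[i] by field.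
    by rewrite scale1r aA [RHS]addrC.
  rewrite hnormZ modulus2.
  have := ler_hnormD (T (T x)) (S (S x)); have := T2 x; have := S2 x.
  have := sqr_ge0 (opnorm T); have := sqr_ge0 (opnorm S).
  have := hnorm_ge0 x; nra.
have T0 : 0 <= opnorm T by apply: sup_nonneg => _ [x _ <-]; exact: hnorm_ge0.
have S0 : 0 <= opnorm S by apply: sup_nonneg => _ [x _ <-]; exact: hnorm_ge0.
have T2w : opnorm T ^+ 2 <= w ^+ 2 by rewrite ler_pXn2r.
have S2w : opnorm S ^+ 2 <= w ^+ 2 by rewrite ler_pXn2r.
(* For either sign of the difference, half the sum plus half the absolute difference is the larger
   square, which [T2w] or [S2w] bounds. *)
case: (ger0P (opnorm T ^+ 2 - opnorm S ^+ 2)) => _; lra.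
Qed.
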